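(* Let $Q$ be a groupoid. Then $Q$ is a quadratical quasigroup if and only if $Q$ is idempotent, bookend and medial.
   Context: A groupoid is a nonempty set with a binary operation, written as juxtaposition. A groupoid $G$ is right solvable if for all $a,b\in G$ there is a unique $x\in G$ with $ax=b$. It has property A if $(xy)x=(zx)(yz)$ for all $x,y,z\in G$. A quadratical groupoid (equivalently, quadratical quasigroup) is a right solvable groupoid with property A; such a groupoid is known to be a quasigroup. A groupoid is idempotent if $xx=x$ for all $x$; bookend if $(yx)(xy)=x$ for all $x,y$; medial if $(xy)(zw)=(xz)(yw)$ for all $x,y,z,w$. *)

(* Defs.v *)
From mathcomp Require Import all_boot.

Set Implicit Arguments.
Unset Strict Implicit.
Unset Printing Implicit Defensive.

(* Idempotency and mediality of [op] are ssrfun's [idempotent_op op] and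
   [interchange op op]. *)
Section Groupoid.

Variables (Q : Type) (op : Q -> Q -> Q).
Local Notation "x * y" := (op x y).

Definition right_solvable : Prop := forall a b, exists! x, a * x = b.

Definition property_A : Prop :=
  forall x y z, (x * y) * x = (z * x) * (y * z).

(* That such an operation is also uniquely solvable in its left argument, i.e.
   that (Q, op) is a quasigroup, is a consequence, not part of the definition. *)
Definition quadratical : Prop := right_solvable /\ property_A.

Definition bookend : Prop := forall x y, (y * x) * (x * y) = x.

End Groupoid.

(* Main.v *)
Require Import Defs.
From mathcomp Require Import all_boot.

(** Both directions revolve around the midpoint x o y := (x * y) * x.  The
    guiding model is the complex plane with x * y := (1 - k) x + k y and
    k = (1 + i) / 2: there x * y is the centre of a square with side [x, y],
    and x o y is the midpoint of x and y.

    Suppose (Q, op) is quadratical.  Property A says that every product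
    (z * x) * (y * z) is the midpoint of x and y, whatever z is; letting z be
    x or y gives idempotency, bookend, elasticity and the symmetry of the
    midpoint.  That symmetry and left cancellation give the exchange rule
    p * y = q * z -> z * p = y * q ([crossed_factors]), from which come
    solvability in the left argument ([left_factor]) and right
    distributivity ([right_distributive_quadratical]).  The freedom of z in
    property A also lets one replace the common factor x in an equality
    (z * x) * r = (w * x) * s by any other ([change_common_factor]).
    Mediality is the obvious equality (x * u) * (v * x) = (x * v) * (u * x)
    of midpoints, multiplied on the right by w and then transformed by this
    replacement.

    Suppose conversely that op is idempotent, bookend and medial.  Then it is
    distributive and elastic.  Writing x as (z * x) * (x * z) and applying
    mediality gives the rule [bookend_shift], which together with
    distributivity shows that (z * x) * (y * z) is the midpoint of x and y,
    i.e. property A.  The same rule gives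
    a * ((b * q) * (q * a)) = (a o b) * q for all q, so (b * q) * (q * a) solves
    a * x = b as soon as (a o b) * q = b, which q := b * (b * a) achieves.  The
    solution is thus a term in a and b; by distributivity left translation by
    a commutes with that term, which forces uniqueness. *)

(** * From quadratical to medial *)

Section Quadratical.

Set Implicit Arguments.

Variables (Q : Type) (op : Q -> Q -> Q).
Local Notation "x * y" := (op x y).

Hypothesis solvable : right_solvable op.
Hypothesis A : property_A op.

Lemma left_cancel (a x y : Q) : a * x = a * y -> x = y.
Proof.
move=> eq_ax_ay; have [t [_ t_unique]] := solvable a (a * y).
by rewrite -(t_unique x eq_ax_ay) (t_unique y).
Qed.

Lemma idempotent_quadratical : idempotent_op op.
Proof. by move=> x; have /left_cancel := A x x x. Qed.

Lemma bookend_quadratical : bookend op.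
Proof. by move=> x y; rewrite -A !idempotent_quadratical. Qed.

Lemma elastic_quadratical (x y : Q) : (x * y) * x = x * (y * x).
Proof. by rewrite (A x y x) idempotent_quadratical. Qed.

(** Taking the free variable of property A equal to y turns the midpoint of
    x and y into that of y and x. *)
Lemma midpoint_sym (x y : Q) : (x * y) * x = (y * x) * y.
Proof. by rewrite (A x y y) idempotent_quadratical. Qed.

(** Multiplied on the left by p * y = q * z, the two sides of the conclusion
    become the midpoints of y, z and of z, y. *)
Lemma crossed_factors (p q y z : Q) : p * y = q * z -> z * p = y * q.
Proof.
move=> eq_py_qz; apply: (@left_cancel (p * y)).
by rewrite -A eq_py_qz -A midpoint_sym.
Qed.

(** Crossing b * u = a * b yields u * a = b * b. *)
Lemma left_factor (a b : Q) : exists u, u * a = b.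
Proof.
have [u [bu_ab _]] := solvable b (a * b).
by exists u; rewrite -(crossed_factors bu_ab) idempotent_quadratical.
Qed.

(** For p with p * x = y * z, hence z * p = x * y, both sides are the
    midpoint of z and p. *)
Lemma right_distributive_quadratical (x y z : Q) :
  (x * y) * z = (x * z) * (y * z).
Proof.
have [p px_yz] := left_factor x (y * z).
by rewrite -(crossed_factors px_yz) -px_yz -A.
Qed.

(** With r = y * z, property A makes (z * x) * r the midpoint of x and y, so
    the hypothesis says s = y * w, which does not involve x. *)
Lemma change_common_factor (x' x z w r s : Q) :
  (z * x) * r = (w * x) * s -> (z * x') * r = (w * x') * s.
Proof.
have [y <-] := left_factor z r.
by rewrite -A (A x y w) => /left_cancel <-; rewrite -!A.
Qed.

Lemma medial_quadratical : interchange op op.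
Proof.
move=> x y z w.
have [u <-] := left_factor x y; have [v <-] := left_factor x z.
rewrite -!elastic_quadratical.
(* Up to the choice of the factor common to x * u and x * v, this is an
   equality between midpoints of u and v, translated by w. *)
apply: (@change_common_factor x w).
by rewrite -!right_distributive_quadratical -!A midpoint_sym.
Qed.

End Quadratical.

(** * From medial to quadratical *)

Section Medial.

Set Implicit Arguments.

Variables (Q : Type) (op : Q -> Q -> Q).
Local Notation "x * y" := (op x y).

Hypothesis idem : idempotent_op op.
Hypothesis book : bookend op.
Hypothesis medial : interchange op op.

Lemma left_distributive_medial (x y z : Q) : x * (y * z) = (x * y) * (x * z).
Proof. by rewrite medial idem. Qed.

Lemma right_distributive_medial (x y z : Q) : (x * y) * z = (x * z) * (y * z).
Proof. by rewrite medial idem. Qed.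

Lemma elastic_medial (x y : Q) : (x * y) * x = x * (y * x).
Proof. by rewrite left_distributive_medial idem. Qed.

(** Substitute (z * x) * (x * z) for the outer x; mediality then assembles
    (x * z) * (z * x), which is z. *)
Lemma bookend_shift (x y z : Q) : x * (y * (z * x)) = ((z * x) * y) * z.
Proof. by rewrite -{1}(book x z) medial book. Qed.

(** Distributivity turns y * (z * x) into (y * z) * (y * x), so that
    [bookend_shift] applies to the right-hand side with y as pivot. *)
Lemma midpoint_product (x y z : Q) : (y * (x * z)) * y = x * (y * (z * x)).
Proof.
by rewrite (left_distributive_medial y z) bookend_shift -left_distributive_medial.
Qed.

Lemma midpoint_independent (x y z : Q) : (y * x) * y = (z * x) * (y * z).
Proof.
(* Decompose x as (z * x) * (x * z); then (x * z) * (z * x) appears, i.e. z. *)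
by rewrite -{1}(book x z) midpoint_product book.
Qed.

Lemma property_A_medial : property_A op.
Proof.
by move=> x y z; rewrite (midpoint_independent y x z) medial.
Qed.

(** In the complex plane, a * y = b forces y = i a + (1 - i) b, which is the
    value of this term. *)
Definition left_division (a b : Q) : Q :=
  let q := b * (b * a) in (b * q) * (q * a).

Lemma mul_left_division (a b : Q) : a * left_division a b = b.
Proof.
rewrite /left_division bookend_shift.
(* The first factor is now the midpoint of a and b. *)
by rewrite -property_A_medial elastic_medial -right_distributive_medial book.
Qed.

Lemma left_division_mul2l (c a b : Q) :
  left_division (c * a) (c * b) = c * left_division a b.
Proof. by rewrite /left_division -!left_distributive_medial. Qed.

Lemma left_division_mul (a b : Q) : left_division a (a * b) = b.
Proof. by rewrite -{1}(idem a) left_division_mul2l mul_left_division. Qed.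

Lemma right_solvable_medial : right_solvable op.
Proof.
move=> a b; exists (left_division a b); split; first exact: mul_left_division.
by move=> x <-; rewrite left_division_mul.
Qed.

End Medial.

Theorem theorem2p11 (Q : Type) (op : Q -> Q -> Q) (Q_nonempty : inhabited Q) :
  quadratical op <->
  [/\ idempotent_op op, bookend op & interchange op op].
Proof.
split=> [[solvable A] | [idem book medial]].
  split; first exact: idempotent_quadratical.
  - exact: bookend_quadratical.
  - exact: medial_quadratical.
split; first exact: right_solvable_medial.
exact: property_A_medial.
Qed.
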